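(* Let $\kappa$ be an algebraically closed field, let $n\geq 1$, and let $x_1,x_2\in\mathfrak{gl}_n(\kappa)$ be nilpotent matrices corresponding to partitions $\pi_1$ and $\pi_2$ of $n$, respectively. If the orbit of $x_2$ is accessible from the orbit of $x_1$ for the conjugation action of $\mathrm{GL}_n(\kappa)$ on $\mathfrak{gl}_n(\kappa)$, then the orbit of $x_2$ is accessible from the orbit of $x_1$ for the conjugation action of $\mathrm{SL}_n(\kappa)$ on $\mathfrak{sl}_n(\kappa)$.
   Context: Nilpotent matrices have trace zero, so $x_1,x_2\in\mathfrak{sl}_n(\kappa)$; the partition of a nilpotent matrix is the multiset of its Jordan block sizes. A cocharacter of a linear algebraic group $G$ is a homomorphism of algebraic groups $\lambda:\mathbb{G}_m\to G$; the set of these is $Y(G)$. If $G$ acts morphically on an affine variety $X$, $x\in X$ and $\lambda\in Y(G)$, we say $\lim_\lambda x=\lim_{a\to 0}\lambda(a)\cdot x$ exists if the morphism $\mathbb{G}_m\to X$, $a\mapsto\lambda(a)\cdot x$, extends to a morphism $\mathbb{A}^1\to X$; the limit is then the image of $0$. An orbit $\mathcal{O}(y)$ is $1$-accessible from $\mathcal{O}(x)$ if there is $\lambda\in Y(G)$ and an element $x'$ of the orbit of $x$ such that $\lim_\lambda x'$ exists and lies in $\mathcal{O}(y)$ (by conjugating $\lambda$ one may equivalently take $x'=x$). $\mathcal{O}(y)$ is accessible from $\mathcal{O}(x)$ if there is a finite chain of orbits from $\mathcal{O}(x)$ to $\mathcal{O}(y)$ in which each orbit is $1$-accessible from the preceding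 one. *)

(* Defs.v *)
From mathcomp Require Import all_boot all_order all_algebra.

Set Implicit Arguments.
Unset Strict Implicit.
Unset Printing Implicit Defensive.

Import GRing.Theory.
Local Open Scope ring_scope.

Section Defs.
Variables (K : fieldType) (n : nat).
Implicit Types (G X : {pred 'M[K]_n}) (x y z g : 'M[K]_n).

Definition GL : {pred 'M[K]_n} := unitmx.
Definition SL : {pred 'M[K]_n} := [pred g | \det g == 1].
Definition gl : {pred 'M[K]_n} := predT.
Definition sl : {pred 'M[K]_n} := [pred x | \tr x == 0].

Definition nilpotent_mx x : Prop := exists k : nat, x ^+ k = 0.

Definition nil_jordan_block (m : nat) : 'M[K]_m :=
  \matrix_(i, j) (i.+1 == j :> nat)%:R.

Definition is_partition (s : seq nat) : Prop :=
  [/\ sorted geq s, all (ltn 0%N) s & sumn s = n].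

(* The cast along e only identifies the total size of the blocks with n. *)
Definition has_jordan_partition x (s : seq nat) : Prop :=
  is_partition s /\
  exists (e : (\sum_(i < size s) nth 0%N s i)%N = n) (g : 'M[K]_n),
    g \in unitmx /\
    x = g *m castmx (e, e) (\mxdiag_(i < size s) nil_jordan_block (nth 0%N s i))
          *m invmx g.

Definition conj_act g x : 'M[K]_n := g *m x *m invmx g.

(* Varieties are described by their K-points, which is harmless over the
   algebraically closed fields these definitions are meant for. Functions on
   the multiplicative group are functions on K whose value at 0 is ignored;
   the coordinate ring of the multiplicative group is K[t, t^-1]. *)
Definition regular_on_Gm (f : K -> K) : Prop :=
  exists (p : {poly K}) (k : nat), forall a, a != 0 -> f a = p.[a] / a ^+ k.

Definition regular_on_A1 (f : K -> K) : Prop :=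
  exists p : {poly K}, forall a, f a = p.[a].

(* For G inside GL, the regularity of the entries is enough: the remaining
   coordinate function of GL is pulled back to
   (\det (lam a))^-1 = \det (lam a^-1), which is then regular as well. *)
Definition cocharacter G (lam : K -> 'M[K]_n) : Prop :=
  [/\ forall a, a != 0 -> lam a \in G,
      forall a b, a != 0 -> b != 0 -> lam (a * b) = lam a *m lam b
    & forall i j, regular_on_Gm (fun a => lam a i j)].

Definition morphism_from_A1 X (phi : K -> 'M[K]_n) : Prop :=
  (forall a, phi a \in X) /\ (forall i j, regular_on_A1 (fun a => phi a i j)).

Definition is_limit X (lam : K -> 'M[K]_n) x y : Prop :=
  exists phi : K -> 'M[K]_n,
    [/\ morphism_from_A1 X phi,
        forall a, a != 0 -> phi a = conj_act (lam a) x
      & phi 0 = y].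

Definition in_orbit G x y : Prop := exists2 g, g \in G & y = conj_act g x.

(* Orbits are given by representatives: "one_accessible G X x y" says that the
   G-orbit of y in X is 1-accessible from that of x. *)
Definition one_accessible G X x y : Prop :=
  exists (lam : K -> 'M[K]_n) (x' y' : 'M[K]_n),
    [/\ cocharacter G lam, in_orbit G x x', is_limit X lam x' y'
      & in_orbit G y y'].

(* A chain of length zero joins x to y when their orbits coincide. *)
Inductive accessible G X : 'M[K]_n -> 'M[K]_n -> Prop :=
| accessible_refl x y : x \in X -> in_orbit G x y -> accessible G X x y
| accessible_step x y z : one_accessible G X x y -> accessible G X y z ->
    accessible G X x z.

End Defs.

Arguments GL {K n}.
Arguments SL {K n}.
Arguments gl {K n}.
Arguments sl {K n}.
Arguments nil_jordan_block {K} m.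

(* Main.v *)
Require Import Defs.
From mathcomp Require Import all_boot all_order all_algebra.

Set Implicit Arguments.
Unset Strict Implicit.
Unset Printing Implicit Defensive.

Import GRing.Theory.
Local Open Scope ring_scope.

(** Conjugation ignores scalars. If [lam] is a cocharacter of GL_n, then
    [a |-> (\det (lam a))^-1 *: lam (a ^+ n)] is a cocharacter of SL_n which acts
    on matrices as [lam (a ^+ n)], so it has the same limits as [lam]. Likewise,
    dividing [g] by an n-th root of [\det g] shows that the GL_n- and SL_n-orbits
    coincide. Finally, the trace is constant along orbits and limits. *)

(** * Closure properties of regular functions on the multiplicative group and the affine line *)

Section RegularFunctions.
Variable K : fieldType.
Implicit Types f g : K -> K.

Lemma regular_on_Gm_ext f g :
  (forall a, a != 0 -> f a = g a) -> regular_on_Gm f -> regular_on_Gm g.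
Proof.
by move=> fg [p [k pE]]; exists p, k => a a0; rewrite -fg // pE.
Qed.

Lemma regular_on_Gm_horner (p : {poly K}) : regular_on_Gm (horner p).
Proof. by exists p, 0%N => a _; rewrite expr0 divr1. Qed.

Lemma regular_on_Gm_cst (c : K) : regular_on_Gm (fun=> c).
Proof.
apply: regular_on_Gm_ext (regular_on_Gm_horner c%:P) => a _.
by rewrite hornerC.
Qed.

Lemma regular_on_GmVX k : regular_on_Gm (fun a : K => a ^- k).
Proof. by exists 1, k => a _; rewrite hornerC div1r. Qed.

Lemma regular_on_GmD f g :
  regular_on_Gm f -> regular_on_Gm g -> regular_on_Gm (fun a => f a + g a).
Proof.
move=> [p [k pE]] [q [l qE]]; exists (p * 'X^l + q * 'X^k), (k + l)%N => a a0.
rewrite pE // qE // hornerD !hornerM !hornerXn exprD.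
by rewrite addf_div ?expf_neq0.
Qed.

Lemma regular_on_GmM f g :
  regular_on_Gm f -> regular_on_Gm g -> regular_on_Gm (fun a => f a * g a).
Proof.
move=> [p [k pE]] [q [l qE]]; exists (p * q), (k + l)%N => a a0.
by rewrite pE // qE // hornerM exprD mulf_div.
Qed.

Lemma regular_on_Gm_sum (I : Type) (r : seq I) (F : I -> K -> K) :
  (forall i, regular_on_Gm (F i)) -> regular_on_Gm (fun a => \sum_(i <- r) F i a).
Proof.
move=> FP; elim: r => [|i r IHr].
  by apply: regular_on_Gm_ext (regular_on_Gm_cst 0) => a _; rewrite big_nil.
apply: regular_on_Gm_ext (regular_on_GmD (FP i) IHr) => a _.
by rewrite big_cons.
Qed.

Lemma regular_on_Gm_prod (I : Type) (r : seq I) (F : I -> K -> K) :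
  (forall i, regular_on_Gm (F i)) -> regular_on_Gm (fun a => \prod_(i <- r) F i a).
Proof.
move=> FP; elim: r => [|i r IHr].
  by apply: regular_on_Gm_ext (regular_on_Gm_cst 1) => a _; rewrite big_nil.
apply: regular_on_Gm_ext (regular_on_GmM (FP i) IHr) => a _.
by rewrite big_cons.
Qed.

Lemma regular_on_Gm_det n (M : K -> 'M[K]_n) :
  (forall i j, regular_on_Gm (fun a => M a i j)) ->
  regular_on_Gm (fun a => \det (M a)).
Proof.
(* [\det] unfolds to the Leibniz sum over permutations [s] of a sign times a product of entries. *)
move=> MP; apply: regular_on_Gm_sum => s.
by apply/regular_on_GmM/regular_on_Gm_prod => //; apply: regular_on_Gm_cst.
Qed.

Lemma regular_on_Gm_compX n f :
  regular_on_Gm f -> regular_on_Gm (fun a => f (a ^+ n)).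
Proof.
move=> [p [k pE]]; exists (p \Po 'X^n), (n * k)%N => a a0.
by rewrite pE ?expf_neq0 // horner_comp hornerXn exprM.
Qed.

Lemma regular_on_Gm_compV f :
  regular_on_Gm f -> regular_on_Gm (fun a => f a^-1).
Proof.
move=> [p [k pE]].
(* Substituting [a^-1] turns [p] into a sum of negative powers and the denominator [a ^+ k] into a
   polynomial factor. *)
have reg_pV : regular_on_Gm (fun a => \sum_(i < size p) p`_i * a ^- i).
  apply: regular_on_Gm_sum => i.
  exact/regular_on_GmM/regular_on_GmVX/regular_on_Gm_cst.
apply: regular_on_Gm_ext (regular_on_GmM reg_pV (regular_on_Gm_horner 'X^k)).
move=> a a0; rewrite pE ?invr_eq0 // hornerXn horner_coef exprVn invrK.
by congr (_ * _); apply: eq_bigr => i _; rewrite exprVn.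
Qed.

Lemma regular_on_A1_compX n f :
  regular_on_A1 f -> regular_on_A1 (fun a => f (a ^+ n)).
Proof.
by move=> [p pE]; exists (p \Po 'X^n) => a; rewrite pE horner_comp hornerXn.
Qed.

Lemma regular_on_A1_sum (I : Type) (r : seq I) (F : I -> K -> K) :
  (forall i, regular_on_A1 (F i)) -> regular_on_A1 (fun a => \sum_(i <- r) F i a).
Proof.
move=> FP; elim: r => [|i r [q qE]].
  by exists 0 => a; rewrite big_nil horner0.
have [p pE] := FP i; exists (p + q) => a.
by rewrite big_cons hornerD -pE -qE.
Qed.

End RegularFunctions.

(** Density of the multiplicative group in the affine line; it carries the trace over to limits. *)
Lemma regular_on_A1_eq0 (K : closedFieldType) (f : K -> K) :
  regular_on_A1 f -> (forall a, a != 0 -> f a = 0) -> f 0 = 0.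
Proof.
move=> [p pE] f0; rewrite pE; suff -> : p = 0 by rewrite horner0.
(* The factor ['X] kills the value at 0, so [p * 'X] vanishes everywhere, while a nonzero polynomial
   over a closed field has a nonroot. *)
have : p * 'X = 0.
  apply/eqP/negPn/negP => /closed_nonrootP[a]; rewrite rootE hornerM hornerX.
  have [->|a0] := eqVneq a 0; first by rewrite mulr0 eqxx.
  by rewrite -pE f0 // mul0r eqxx.
by move/eqP; rewrite mulf_eq0 polyX_eq0 orbF => /eqP.
Qed.

(** * Traces under conjugation, and the passage from cocharacters of GL to cocharacters of SL *)

Section Conjugation.
Variables (K : fieldType) (n : nat).
Implicit Types (x g : 'M[K]_n) (lam : K -> 'M[K]_n).

Lemma mxtrace_conj_act g x : g \in unitmx -> \tr (conj_act g x) = \tr x.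
Proof. by move=> gU; rewrite /conj_act mxtrace_mulC mulmxA mulVmx // mul1mx. Qed.

Lemma conj_actZ (c : K) g x :
  c != 0 -> g \in unitmx -> conj_act (c *: g) x = conj_act g x.
Proof.
move=> c0 gU; rewrite /conj_act invmxZ; last by rewrite unitmxZ ?unitfE.
by rewrite -!scalemxAl -scalemxAr scalerA divff // scale1r.
Qed.

Lemma mxtrace_in_orbit_GL x y : Defs.in_orbit GL x y -> \tr y = \tr x.
Proof. by case=> g gU ->; apply: mxtrace_conj_act. Qed.

Lemma mxtrace_castmx m (e : m = n) (A : 'M[K]_m) : \tr (castmx (e, e) A) = \tr A.
Proof. by case: n / e; rewrite castmx_id. Qed.

Lemma mxtrace_nil_jordan_block m : \tr (nil_jordan_block m : 'M[K]_m) = 0.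
Proof. by apply: big1 => i _; rewrite mxE gtn_eqF. Qed.

(** This puts the starting point [x1] of the chain in [sl]. *)
Lemma mxtrace_jordan_partition x s : has_jordan_partition x s -> \tr x = 0.
Proof.
case=> _ [e [g [gU ->]]]; rewrite [LHS]mxtrace_conj_act // mxtrace_castmx.
by rewrite mxtrace_mxdiag big1 // => i _; apply: mxtrace_nil_jordan_block.
Qed.

(** By multiplicativity [lam 1] is idempotent, and an invertible idempotent is the identity. *)
Lemma cocharacter1 lam : cocharacter GL lam -> lam 1 = 1%:M.
Proof.
case=> lamU lamM _; have U1 := lamU 1 (oner_neq0 K).
have := lamM 1 1 (oner_neq0 _) (oner_neq0 _); rewrite mulr1.
by move/(congr1 (mulmx (invmx (lam 1)))); rewrite mulmxA mulVmx ?mul1mx.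
Qed.

Lemma cocharacter_det_neq0 lam a : cocharacter GL lam -> a != 0 -> \det (lam a) != 0.
Proof. by case=> lamU _ _ /lamU; rewrite /GL unitmxE unitfE. Qed.

Lemma cocharacter_detV lam a :
  cocharacter GL lam -> a != 0 -> \det (lam a^-1) = (\det (lam a))^-1.
Proof.
move=> lamP a0; apply: (mulfI (cocharacter_det_neq0 lamP a0)).
rewrite divff ?cocharacter_det_neq0 // -det_mulmx.
have [_ lamM _] := lamP.
by rewrite -lamM ?invr_eq0 // divff // cocharacter1 // det1.
Qed.

Lemma cocharacter_detX lam a k :
  cocharacter GL lam -> a != 0 -> \det (lam (a ^+ k)) = \det (lam a) ^+ k.
Proof.
move=> lamP a0; have [_ lamM _] := lamP.
elim: k => [|k IHk]; first by rewrite !expr0 cocharacter1 // det1.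
by rewrite !exprS lamM ?expf_neq0 // det_mulmx IHk.
Qed.

(** An n-th root of [\det (lam a)] need not be regular in [a]; after precomposition with [a ^+ n]
    the determinant becomes [\det (lam a) ^+ n], which has a regular root. *)
Definition SL_cocharacter lam (a : K) : 'M[K]_n :=
  (\det (lam a))^-1 *: lam (a ^+ n).

Lemma SL_cocharacterP lam : cocharacter GL lam -> cocharacter SL (SL_cocharacter lam).
Proof.
move=> lamP; have [lamU lamM lamR] := lamP; split.
- move=> a a0; rewrite inE detZ cocharacter_detX // exprVn.
  by rewrite mulVf ?expf_neq0 ?cocharacter_det_neq0.
- move=> a b a0 b0; rewrite /SL_cocharacter exprMn !lamM ?expf_neq0 //.
  by rewrite det_mulmx invfM -scalemxAl -scalemxAr scalerA.
- move=> i j.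
  (* The inverse determinant is regular because it equals [\det (lam a^-1)]. *)
  have detVR := regular_on_Gm_compV (regular_on_Gm_det lamR).
  apply: regular_on_Gm_ext (regular_on_GmM detVR (regular_on_Gm_compX n (lamR i j))).
  by move=> a a0; rewrite mxE cocharacter_detV.
Qed.

End Conjugation.

(** * Transfer of orbits, limits and chains from GL to SL *)

Section ClosedField.
Variables (K : closedFieldType) (n : nat).
Hypothesis n_gt0 : (0 < n)%N.
Implicit Types x y : 'M[K]_n.

Lemma in_orbit_GL_SL x y : Defs.in_orbit GL x y -> Defs.in_orbit SL x y.
Proof.
case=> g gU ->.
(* With only the constant coefficient nonzero, the monic equation reads [c ^+ n = \det g]. *)
have [c cE] := solve_monicpoly (fun i => if i == 0%N then \det g else 0) n_gt0.
have {}cE : c ^+ n = \det g.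
  rewrite cE (bigD1 (Ordinal n_gt0)) //= mulr1 big1 ?addr0 // => i.
  by rewrite -val_eqE /= => /negPf->; rewrite mul0r.
have det0 : \det g != 0 by rewrite -unitfE -unitmxE.
have c0 : c != 0 by apply: contraNneq det0 => c0; rewrite -cE c0 expr0n gtn_eqF.
exists (c^-1 *: g); last by rewrite conj_actZ ?invr_eq0.
by rewrite inE detZ exprVn cE mulVf.
Qed.

Lemma is_limit_GL_mxtrace lam x y :
  cocharacter GL lam -> is_limit gl lam x y -> \tr y = \tr x.
Proof.
move=> [lamU _ _] [phi [[_ phiR] phiE <-]]; apply/eqP; rewrite -subr_eq0; apply/eqP.
apply: (regular_on_A1_eq0 (f := fun a => \tr (phi a) - \tr x)) => [|a a0].
  have [p pE] := regular_on_A1_sum (index_enum 'I_n) (fun i => phiR i i).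
  by exists (p - (\tr x)%:P) => a; rewrite hornerD hornerN hornerC -pE.
by rewrite phiE // mxtrace_conj_act ?subrr //; apply: lamU.
Qed.

Lemma is_limit_GL_SL lam x y :
  cocharacter GL lam -> \tr x = 0 -> is_limit gl lam x y ->
  is_limit sl (SL_cocharacter lam) x y.
Proof.
move=> lamP trx limy; have [lamU _ _] := lamP.
have lamXU a : a != 0 -> lam (a ^+ n) \in unitmx by move=> a0; apply/lamU/expf_neq0.
have trlim := is_limit_GL_mxtrace lamP limy.
have [phi [[_ phiR] phiE phi0]] := limy.
(* Reparametrizing by [a ^+ n] keeps the value at 0, since [0 ^+ n = 0] for positive [n]. *)
exists (fun a => phi (a ^+ n)); split; last by rewrite expr0n gtn_eqF.
  split=> [a | i j]; last exact: regular_on_A1_compX (phiR i j).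
  rewrite inE; have [->|a0] := eqVneq a 0.
    by rewrite expr0n gtn_eqF // phi0 trlim trx.
  by rewrite phiE ?expf_neq0 // mxtrace_conj_act ?trx // lamXU.
move=> a a0; rewrite phiE ?expf_neq0 // /SL_cocharacter conj_actZ ?lamXU //.
by rewrite invr_eq0 cocharacter_det_neq0.
Qed.

Lemma one_accessible_GL_mxtrace x y : one_accessible GL gl x y -> \tr y = \tr x.
Proof.
case=> lam [x' [y' [lamP xx' limy yy']]].
by rewrite -(mxtrace_in_orbit_GL yy') (is_limit_GL_mxtrace lamP limy)
           (mxtrace_in_orbit_GL xx').
Qed.

Lemma one_accessible_GL_SL x y :
  \tr x = 0 -> one_accessible GL gl x y -> one_accessible SL sl x y.
Proof.
move=> trx [lam [x' [y' [lamP xx' limy yy']]]].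
exists (SL_cocharacter lam), x', y'; split; try exact: in_orbit_GL_SL.
  exact: SL_cocharacterP.
by apply: is_limit_GL_SL; rewrite ?(mxtrace_in_orbit_GL xx').
Qed.

Lemma accessible_GL_SL x y :
  \tr x = 0 -> accessible GL gl x y -> accessible SL sl x y.
Proof.
(* The trace hypothesis is part of the induction, since each intermediate point must again lie in
   [sl]. *)
move=> trx acc; elim: acc trx => {x y} [x y _ xy | x y z xy _ IH] trx.
  by apply: accessible_refl; [rewrite inE trx | apply: in_orbit_GL_SL].
apply: accessible_step (one_accessible_GL_SL trx xy) (IH _).
by rewrite (one_accessible_GL_mxtrace xy).
Qed.

End ClosedField.

Theorem lemma3p6 (K : closedFieldType) (n : nat) (hn : (1 <= n)%N)
    (x1 x2 : 'M[K]_n) (pi1 pi2 : seq nat)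
    (nil1 : nilpotent_mx x1) (nil2 : nilpotent_mx x2)
    (hpi1 : has_jordan_partition x1 pi1)
    (hpi2 : has_jordan_partition x2 pi2) :
  accessible GL gl x1 x2 -> accessible SL sl x1 x2.
Proof. exact/accessible_GL_SL/(mxtrace_jordan_partition hpi1). Qed.
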